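(* Let $m\ge n$, $0\le r<n$, $A^1,\dots,A^l\in\mathbb{R}^{m\times n}$, $b\in\mathbb{R}^l$, and $X\in\mathcal{L}\cap\mathcal{M}(r)$ with $s=\operatorname{rank}(X)$ and SVD $X=U\Sigma V^\top$ as in the context. (i) If $s=r$ and Assumption 1 holds at $X$, then $\mathrm{N}^F_{\mathcal{L}\cap\mathcal{M}(r)}(X)=\mathrm{N}_{\mathcal{L}}(X)+\mathrm{N}^F_{\mathcal{M}(r)}(X)$. (ii) If $s<r$ and Assumption 2 holds at $X$, then $\mathrm{N}^F_{\mathcal{L}\cap\mathcal{M}(r)}(X)=\mathrm{N}_{\mathcal{L}}(X)+\mathrm{N}^F_{\mathcal{M}(r)}(X)=\mathrm{N}_{\mathcal{L}}(X)$.
   Context: $\langle X,Y\rangle=\sum_{i,j}X_{ij}Y_{ij}$. $\mathcal{A}(X)=(\langle A^1,X\rangle,\dots,\langle A^l,X\rangle)^\top$, $\mathcal{L}=\{X:\mathcal{A}(X)=b\}$, $\mathrm{N}_{\mathcal{L}}(X)=\{\sum_i y_iA^i:y\in\mathbb{R}^l\}$, $\mathcal{M}(r)=\{X:\operatorname{rank}(X)\le r\}$. For closed $\Omega$ and $X\in\Omega$: $\mathrm{T}^B_\Omega(X)$ is the set of $\Xi$ with $X^k\in\Omega$, $X^k\to X$, $t_k\downarrow0$, $(X^k-X)/t_k\to\Xi$; $\mathrm{N}^F_\Omega(X)=\{Y:\langle Y,\Xi\rangle\le0\ \forall\Xi\in\mathrm{T}^B_\Omega(X)\}$. SVD convention: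 $X=U\Sigma V^\top$, $U$, $V$ orthogonal of sizes $m$, $n$, $\Sigma$ with diagonal $\sigma_1\ge\dots\ge\sigma_s>0$ followed by zeros, $\Gamma=\{1,\dots,s\}$, $\Gamma_m^\perp=\{s+1,\dots,m\}$, $\Gamma_n^\perp=\{s+1,\dots,n\}$, $U_J,V_J$ column submatrices indexed by $J$. Define $T^i_X=\begin{bmatrix}U_\Gamma^\top A^iV_\Gamma & U_\Gamma^\top A^iV_{\Gamma_n^\perp}\\ U_{\Gamma_m^\perp}^\top A^iV_\Gamma & O\end{bmatrix}$ and $R^i_X=U^\top A^iV_\Gamma$, $i=1,\dots,l$. Assumption 1 at $X$: $T^1_X,\dots,T^l_X$ linearly independent. Assumption 2 at $X$: $R^1_X,\dots,R^l_X$ linearly independent. *)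

(* Defs.v *)
From HB Require Import structures.
From mathcomp Require Import all_boot all_order all_algebra.
From mathcomp Require Import all_classical all_reals all_analysis.
Set Implicit Arguments. Unset Strict Implicit. Unset Printing Implicit Defensive.
Import Order.TTheory GRing.Theory Num.Theory.
Import numFieldNormedType.Exports.
Local Open Scope classical_set_scope.
Local Open Scope ring_scope.

Section Defs.
Variable R : realType.

Definition frob {m n : nat} (X Y : 'M[R]_(m, n)) : R :=
  \sum_(i < m) \sum_(j < n) X i j * Y i j.

Definition affine_set {m n l : nat} (A : 'I_l -> 'M[R]_(m, n)) (b : 'I_l -> R)
  : set 'M[R]_(m, n) := [set X | forall i, frob (A i) X = b i].

Definition normal_affine {m n l : nat} (A : 'I_l -> 'M[R]_(m, n))
  : set 'M[R]_(m, n) := [set Y | exists y : 'I_l -> R, Y = \sum_(i < l) y i *: A i].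

Definition low_rank (m n r : nat) : set 'M[R]_(m, n) :=
  [set X | (\rank X <= r)%N].

Definition bouligand_tangent {m n : nat} (Om : set 'M[R]_(m, n)) (X : 'M[R]_(m, n))
  : set 'M[R]_(m, n) :=
  [set Xi | exists (Xs : nat -> 'M[R]_(m, n)) (t : nat -> R),
     (forall k, Om (Xs k)) /\ Xs @ \oo --> X /\
     (forall k, 0 < t k) /\ {homo t : a b / (a <= b)%N >-> b <= a} /\
     t @ \oo --> (0 : R) /\
     (fun k => (t k)^-1 *: (Xs k - X)) @ \oo --> Xi].

Definition frechet_normal {m n : nat} (Om : set 'M[R]_(m, n)) (X : 'M[R]_(m, n))
  : set 'M[R]_(m, n) :=
  [set Y | forall Xi, bouligand_tangent Om X Xi -> frob Y Xi <= 0].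

Definition mx_minkowski_sum {m n : nat} (S1 S2 : set 'M[R]_(m, n)) : set 'M[R]_(m, n) :=
  [set Z | exists Y1 Y2, S1 Y1 /\ S2 Y2 /\ Z = Y1 + Y2].

Definition lin_indep {p q l : nat} (F : 'I_l -> 'M[R]_(p, q)) : Prop :=
  forall c : 'I_l -> R, \sum_(i < l) c i *: F i = 0 -> forall i, c i = 0.

Definition orthogonal_mx {k : nat} (U : 'M[R]_k) : Prop := U^T *m U = 1%:M.

Definition svd_diag {m n : nat} (s : nat) (S : 'M[R]_(m, n)) : Prop :=
  [/\ forall (i : 'I_m) (j : 'I_n), (i : nat) <> j -> S i j = 0,
      forall (i : 'I_m) (j : 'I_n), (i : nat) = j -> (i < s)%N -> 0 < S i j,
      forall (i : 'I_m) (j : 'I_n), (i : nat) = j -> (s <= i)%N -> S i j = 0 &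
      forall (i i' : 'I_m) (j j' : 'I_n), (i : nat) = j -> (i' : nat) = j' ->
        (i <= i')%N -> (i' < s)%N -> S i' j' <= S i j].

Definition is_svd {m n : nat} (X : 'M[R]_(m, n)) (s : nat)
  (U : 'M[R]_m) (S : 'M[R]_(m, n)) (V : 'M[R]_n) : Prop :=
  [/\ orthogonal_mx U, orthogonal_mx V, svd_diag s S & X = U *m S *m V^T].

(* T^i_X = [[U_G^T A V_G, U_G^T A V_Gperp]; [U_Gperp^T A V_G, O]] :
   the m x n matrix U^T A V with its lower-right (m-s) x (n-s) block zeroed. *)
Definition T_mx {m n : nat} (s : nat) (U : 'M[R]_m) (V : 'M[R]_n)
  (A : 'M[R]_(m, n)) : 'M[R]_(m, n) :=
  \matrix_(i < m, j < n)
     (if ((i < s)%N || (j < s)%N) then (U^T *m A *m V) i j else 0).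

(* R^i_X = U^T A V_G, an m x s matrix (V_G = first s columns of V) *)
Definition R_mx {m n : nat} (s : nat) (Hs : (s <= n)%N) (U : 'M[R]_m)
  (V : 'M[R]_n) (A : 'M[R]_(m, n)) : 'M[R]_(m, s) :=
  \matrix_(i < m, j < s) (U^T *m A *m V) i (widen_ord Hs j).

End Defs.
Arguments low_rank {R} m n r.

(* Main.v *)
Require Import Defs.
From HB Require Import structures.
From mathcomp Require Import all_boot all_order all_algebra.
From mathcomp Require Import all_classical all_reals all_analysis.
Set Implicit Arguments.
Unset Strict Implicit.
Unset Printing Implicit Defensive.
Import Order.TTheory GRing.Theory Num.Theory.
Import numFieldNormedType.Exports.
Local Open Scope classical_set_scope.
Local Open Scope ring_scope.

(* The sum is always contained in the normal cone of the intersection.  For the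
   converse, the curve [(1 + t H X^T) X (1 + t X^T H)] stays among the matrices
   of rank at most [rank X], with initial velocity [v H = X X^T H + H X^T X].
   The operator [v] is self-adjoint and [<H, v H> = |X^T H|^2 + |H X^T|^2], so
   its kernel is the normal space [{Y | X^T Y = 0, Y X^T = 0}].

   If [rank X = r], Assumption 1 says that no nontrivial combination of the
   [A_i] lies in this kernel, hence that the constraints are onto on the range
   of [v].  By Lyusternik's argument, in which a fixed point absorbs the second
   order error of the curve, every [v H] orthogonal to the [A_i] is tangent to
   the intersection.  So a normal [Y], corrected by a combination of the [A_i],
   becomes orthogonal to the whole range of [v], i.e. it lies in the normal
   space.

   If [rank X < r], the lines [X + t (E - G X)] with [E] of rank one have rank
   at most [r].  Assumption 2 provides, for every such [E], a [G] making the
   line feasible, so the constraints determine a normal [Y] on all rank-one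
   matrices. *)

Section Frobenius.
Variable R : realType.
Implicit Types m n p : nat.

Lemma frobC m n (A B : 'M[R]_(m, n)) : frob A B = frob B A.
Proof. by apply: eq_bigr => i _; apply: eq_bigr => j _; rewrite mulrC. Qed.

Lemma frob_trace m n (A B : 'M[R]_(m, n)) : frob A B = \tr (A^T *m B).
Proof.
rewrite /frob exchange_big; apply: eq_bigr => j _ /=; rewrite mxE.
by apply: eq_bigr => i _; rewrite mxE.
Qed.

Fact frob_is_scalar m n (A : 'M[R]_(m, n)) : scalar (frob A).
Proof.
by move=> a B C; rewrite !frob_trace mulmxDr -scalemxAr mxtraceD mxtraceZ.
Qed.

HB.instance Definition _ m n (A : 'M[R]_(m, n)) :=
  GRing.isLinear.Build R 'M[R]_(m, n) R *%R (frob A) (frob_is_scalar A).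

Lemma frobDl m n (A B C : 'M[R]_(m, n)) : frob (A + B) C = frob A C + frob B C.
Proof. by rewrite frobC linearD /= !(frobC C). Qed.

Lemma frobBl m n (A B C : 'M[R]_(m, n)) : frob (A - B) C = frob A C - frob B C.
Proof. by rewrite frobC linearB /= !(frobC C). Qed.

Lemma frob_lincombr m n (I : finType) (c : I -> R) (A : 'M[R]_(m, n)) B :
  frob A (\sum_i c i *: B i) = \sum_i c i * frob A (B i).
Proof. by rewrite linear_sum; apply: eq_bigr => i _; rewrite scalarZ. Qed.

Lemma frob_lincombl m n (I : finType) (c : I -> R) (A : I -> 'M[R]_(m, n)) B :
  frob (\sum_i c i *: A i) B = \sum_i c i * frob (A i) B.
Proof.
by rewrite frobC frob_lincombr; apply: eq_bigr => i _; rewrite frobC.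
Qed.

Lemma frob_mulmxl m n p (A : 'M[R]_(m, n)) (L : 'M[R]_(m, p)) G :
  frob A (L *m G) = frob (L^T *m A) G.
Proof. by rewrite !frob_trace trmx_mul trmxK mulmxA. Qed.

Lemma frob_mulmxr m n p (A : 'M[R]_(m, n)) (C : 'M[R]_(m, p)) Q :
  frob A (C *m Q) = frob (A *m Q^T) C.
Proof. by rewrite !frob_trace trmx_mul trmxK mulmxA mxtrace_mulC mulmxA. Qed.

Lemma frob_delta m n (A : 'M[R]_(m, n)) i j : frob A (delta_mx i j) = A i j.
Proof.
rewrite frob_trace -(mul_delta_mx (0 : 'I_1)) mulmxA mxtrace_mulC mulmxA -rowE.
by rewrite -colE trace_mx11 !mxE.
Qed.

Lemma frob_ge0 m n (A : 'M[R]_(m, n)) : 0 <= frob A A.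
Proof. by apply: sumr_ge0 => i _; apply: sumr_ge0 => j _; exact: sqr_ge0. Qed.

Lemma frob_eq0 m n (A : 'M[R]_(m, n)) : frob A A = 0 -> A = 0.
Proof.
rewrite /frob pair_bigA => /psumr_eq0P A0; apply/matrixP => i j.
have /eqP := A0 (fun ij _ => sqr_ge0 (A ij.1 ij.2)) (i, j) isT.
by rewrite mulf_eq0 orbb mxE => /eqP.
Qed.

End Frobenius.

Section Independence.
Variables (R : realType) (l m n : nat).
Implicit Types A B : 'I_l -> 'M[R]_(m, n).

Definition lin_indep_mod (N : set 'M[R]_(m, n)) A : Prop :=
  forall c : 'I_l -> R, N (\sum_i c i *: A i) -> forall i, c i = 0.

Lemma lin_indep_modP p q (F : {linear 'M[R]_(m, n) -> 'M[R]_(p, q)}) A :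
  lin_indep (fun i => F (A i)) <-> lin_indep_mod [set Z | F Z = 0] A.
Proof.
have FA c : F (\sum_i c i *: A i) = \sum_i c i *: F (A i).
  by rewrite linear_sum; apply: eq_bigr => i _; rewrite linearZ.
by split => indA c; [rewrite /= FA|rewrite -FA]; exact: indA.
Qed.

Lemma sub_lin_indep_mod (N N' : set 'M[R]_(m, n)) A :
  N `<=` N' -> lin_indep_mod N' A -> lin_indep_mod N A.
Proof. by move=> NN' indA c /NN'; exact: indA. Qed.

Definition biorthogonal A B : Prop :=
  forall i j, frob (A i) (B j) = (i == j)%:R.

Lemma lin_indep_biorthogonal A : lin_indep A -> exists B, biorthogonal A B.
Proof.
move=> indA; pose gram := \matrix_(i, j) frob (A i) (A j).
have gram_unit : gram \in unitmx.
  rewrite -row_free_unit; apply: inj_row_free => u u_gram.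
  apply/rowP => i; rewrite mxE; apply: indA; apply: frob_eq0.
  rewrite frob_lincombr big1 // => j _; rewrite frob_lincombl.
  have /rowP/(_ j) := u_gram; rewrite !mxE.
  by under eq_bigr do rewrite mxE; move=> ->; rewrite mulr0.
exists (fun j => \sum_k invmx gram k j *: A k) => i j.
have /matrixP/(_ i j) := mulmxV gram_unit; rewrite !mxE => <-.
by rewrite frob_lincombr; apply: eq_bigr => k _; rewrite mxE mulrC.
Qed.

Definition frob_expansion p q A (B : 'I_l -> 'M[R]_(p, q)) (Z : 'M[R]_(m, n)) :=
  \sum_i frob (A i) Z *: B i.

Fact frob_expansion_is_linear p q A (B : 'I_l -> 'M[R]_(p, q)) :
  linear (frob_expansion A B).
Proof.
move=> a Y Z; rewrite /frob_expansion scaler_sumr -big_split.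
by apply: eq_bigr => i _; rewrite linearP scalerDl scalerA.
Qed.

HB.instance Definition _ p q A (B : 'I_l -> 'M[R]_(p, q)) :=
  GRing.isLinear.Build R 'M[R]_(m, n) 'M[R]_(p, q) *:%R (frob_expansion A B)
    (frob_expansion_is_linear A B).

Lemma linear_frob_expansion p q p' q'
    (f : {linear 'M[R]_(p, q) -> 'M[R]_(p', q')}) A
    (B : 'I_l -> 'M[R]_(p, q)) Z :
  f (frob_expansion A B Z) = frob_expansion A (fun i => f (B i)) Z.
Proof. by rewrite linear_sum; apply: eq_bigr => i _; rewrite linearZ. Qed.

Lemma frob_expansion_adjoint A B Y Z :
  frob (frob_expansion B A Y) Z = frob Y (frob_expansion A B Z).
Proof.
rewrite frob_lincombl frob_lincombr; apply: eq_bigr => i _.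
by rewrite mulrC (frobC (B i)).
Qed.

Lemma frob_expansion_biorthogonal A B Z i :
  biorthogonal A B -> frob (A i) (frob_expansion A B Z) = frob (A i) Z.
Proof.
move=> AB; rewrite frob_lincombr (bigD1 i) //= AB eqxx mulr1.
by rewrite big1 ?addr0 // => j /negbTE ji; rewrite AB eq_sym ji mulr0.
Qed.

End Independence.

HB.instance Definition _ (R : realType) (m n : nat) := Complete.on 'M[R]_(m, n).

Section MatrixTopology.
Variable R : realFieldType.
Implicit Types m n p : nat.

Lemma mx_linear_continuous m n (W : normedModType R)
    (f : {linear 'M[R]_(m, n) -> W}) : continuous f.
Proof.
have -> : f = (fun A => \sum_i \sum_j A i j *: f (delta_mx i j)) :> (_ -> _).
  apply/funext => A; rewrite {1}(matrix_sum_delta A) linear_sum.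
  apply: eq_bigr => i _; rewrite linear_sum; apply: eq_bigr => j _.
  by rewrite linearZ.
do 2!(apply: continuous_big => [|? _]; first exact: add_continuous).
move=> A; apply: (@continuousZ _ _ _ (fun M : 'M[R]_(m, n) => M _ _)).
  exact: coord_continuous.
exact: cst_continuous.
Qed.

Lemma cvg_mx_linear m n (W : normedModType R) (f : {linear 'M[R]_(m, n) -> W})
    (T : Type) (F : set_system T) {FF : Filter F} (u : T -> 'M[R]_(m, n)) A :
  u @ F --> A -> f (u x) @[x --> F] --> f A.
Proof. by move=> uA; apply: continuous_cvg uA; apply: mx_linear_continuous. Qed.

Lemma det_continuous n : continuous (fun A : 'M[R]_n => \det A).
Proof.
apply: continuous_big => [|s _ A]; first exact: add_continuous.
apply: (@continuousM _ _ (fun=> _)); first exact: cst_continuous.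
apply: continuous_big => [|i _]; first exact: mul_continuous.
exact: coord_continuous.
Qed.

Lemma mx_norm_mulmx m n p (A : 'M[R]_(m, n)) (B : 'M[R]_(n, p)) :
  `|A *m B| <= n%:R * `|A| * `|B|.
Proof.
have coord_le q r (M : 'M[R]_(q, r)) i j : `|M i j| <= `|M|.
  by rewrite [leRHS]mx_normrE; exact: (le_bigmax _ _ (i, j)).
rewrite [leLHS]mx_normrE; apply/bigmax_leP; split=> [|[i j] _ /=].
  by rewrite !mulr_ge0.
rewrite mxE (le_trans (ler_norm_sum _ _ _))// -mulrA.
have -> : n%:R * (`|A| * `|B|) = \sum_(k < n) `|A| * `|B|.
  by rewrite sumr_const card_ord mulr_natl.
by apply: ler_sum => k _; rewrite normrM ler_pM.
Qed.

End MatrixTopology.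

Lemma frob_continuous (R : realType) m n (A : 'M[R]_(m, n)) :
  continuous (frob A).
Proof.
do 2!(apply: continuous_big => [|? _]; first exact: add_continuous).
move=> B; apply: (@continuousM _ _ (fun=> _) (fun M : 'M[R]_(m, n) => M _ _)).
  exact: cst_continuous.
exact: coord_continuous.
Qed.

Section Lipschitz.
Variable R : realFieldType.

Lemma lipschitz_on_quadratic m n (K : 'M[R]_(n, m)) (H : 'M[R]_(m, n)) :
  lipschitz_on (fun Z => Z *m K *m Z) (nbhs (H, H)).
Proof.
pose c := m%:R * (n%:R * `|K|); pose a := `|H| + 1.
have mulmxK_le (Y Z : 'M[R]_(m, n)) : `|Y *m K *m Z| <= c * (`|Y| * `|Z|).
  have -> : c * (`|Y| * `|Z|) = m%:R * (n%:R * `|Y| * `|K|) * `|Z|.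
    by rewrite (mulrAC n%:R) -!mulrA.
  rewrite (le_trans (mx_norm_mulmx _ _))// ler_wpM2r// ler_wpM2l//.
  exact: mx_norm_mulmx.
have near_le : \forall Z \near H, `|Z| <= a.
  near=> Z; rewrite -(subrK H Z) addrC (le_trans (ler_normD _ _))// lerD2l.
  by near: Z; exact: cvgr_distC_le.
apply: (@klipschitzW _ _ _ (c * (a + a))); rewrite /dominated_by.
exists ([set Z | `|Z| <= a], [set Z | `|Z| <= a]) => // -[Z W] [/= Z_le W_le].
have -> : Z *m K *m Z - W *m K *m W = (Z - W) *m K *m Z + W *m K *m (Z - W).
  by rewrite !mulmxBl mulmxBr addrA subrK.
rewrite (le_trans (ler_normD _ _))// -mulrA mulrDl mulrDr lerD//.
  rewrite (le_trans (mulmxK_le _ _))// ler_wpM2l ?mulr_ge0//.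
  by rewrite mulrC ler_wpM2r.
by rewrite (le_trans (mulmxK_le _ _))// ler_wpM2l ?mulr_ge0// ler_wpM2r.
Unshelve. all: by end_near. Qed.

Lemma lipschitz_on_continuous (V W : normedModType R) (f : V -> W) a :
  lipschitz_on f (nbhs (a, a)) -> {for a, continuous f}.
Proof.
move=> /pinfty_ex_gt0[k k0 f_lip]; apply/cvgrPdist_le => e e0.
have pair_cvg : (fun x => (a, x)) @ nbhs a --> (a, a).
  by apply: cvg_pair; [exact: cvg_cst|exact: cvg_id].
near=> x; rewrite (@le_trans _ _ (k * `|a - x|))//.
  by near: x; exact: (pair_cvg _ f_lip).
rewrite mulrC -ler_pdivlMr//; near: x; apply: cvgr_dist_le; first exact: cvg_id.
exact: divr_gt0.
Unshelve. all: by end_near. Qed.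

Lemma lipschitz_on_linear_shift (V W : normedModType R) m n
    (f : {linear 'M[R]_(m, n) -> W}) (g : V -> 'M[R]_(m, n)) a :
  lipschitz_on g (nbhs (a, a)) ->
  lipschitz_on (fun x => f (g (a + x))) (nbhs (0, 0)).
Proof.
move=> /pinfty_ex_gt0[k k0 g_lip].
have [c c0 f_le] := linear_lipschitz (@mx_linear_continuous _ _ _ _ f).
apply: (@klipschitzW _ _ _ (c * k)).
have shift_cvg :
    (fun p : V * V => (a + p.1, a + p.2)) @ nbhs (0, 0) --> (a + 0, a + 0).
  apply: cvg_pair; apply: cvgD; do ?exact: cvg_cst.
    exact: cvg_fst.
  exact: cvg_snd.
rewrite !addr0 in shift_cvg.
have := shift_cvg _ g_lip.
apply: (@filterS _ (nbhs ((0 : V), (0 : V)))) => -[x y] /=.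
rewrite opprD addrACA subrr add0r -linearB -mulrA => g_dist.
by rewrite (le_trans (f_le _))// ler_pM2l.
Qed.

End Lipschitz.

Section FixedPoint.
Variables (R : realType) (V : completeNormedModType R).
Implicit Types phi : V -> V.

Lemma scaled_lipschitz_fixed_point phi k d t :
  0 <= k -> 0 <= d -> k.-lipschitz_[set x : V | `|x| <= d] phi ->
  `|t| * (`|phi 0| + k * d) <= d -> `|t| * k < 1 ->
  exists2 x, `|x| <= `|t| * (`|phi 0| + k * d) & x = t *: phi x.
Proof.
move=> k0 d0 phi_lip tM tk; pose B := [set x : V | `|x| <= d].
have B0 : B 0 by rewrite /B /= normr0.
have closedB : closed B.
  have -> : B = closed_ball_ Num.norm 0 d.
    by apply/funext => x; rewrite /closed_ball_ /= sub0r normrN.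
  exact: closed_closed_ball_.
have phi_le x : B x -> `|phi x| <= `|phi 0| + k * d.
  move=> Bx; rewrite -(subrK (phi 0) (phi x)) addrC.
  rewrite (le_trans (ler_normD _ _))// lerD2l.
  by rewrite (le_trans (phi_lip (x, 0) _))//= subr0 ler_wpM2l.
have stable : set_fun B B (fun x => t *: phi x).
  by move=> x Bx; rewrite /B /= normrZ (le_trans _ tM)// ler_wpM2l// phi_le.
have tk0 : 0 <= `|t| * k by rewrite mulr_ge0.
have contr : is_contraction (mkfun stable).
  exists (NngNum tk0); split=> // -[x y] /= Bxy.
  by rewrite -scalerBr normrZ -mulrA ler_wpM2l// (phi_lip (x, y)).
have [|x Bx xE] := banach_fixed_point contr closedB; first by exists 0.
by exists x => //; rewrite {1}xE normrZ ler_wpM2l// phi_le.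
Qed.

Lemma small_scaling_fixed_point phi :
  lipschitz_on phi (nbhs (0, 0)) ->
  exists2 w : R -> V,
    w t @[t --> 0] --> 0 & \forall t \near 0, w t = t *: phi (w t).
Proof.
move=> /pinfty_ex_gt0[k k0 /nbhs_ballP[e /= e0 phi_lip]].
pose d := e / 2; have d0 : 0 < d by rewrite divr_gt0.
have phi_lip_d : k.-lipschitz_[set x : V | `|x| <= d] phi.
  have de : d < e by rewrite ltr_pdivrMr// mulr_natr mulr2n ltrDl.
  move=> [x y] /= [x_le y_le]; apply: (phi_lip (x, y)).
  by split; rewrite -ball_normE /= sub0r normrN; exact: le_lt_trans de.
pose M := `|phi 0| + k * d.
have M0 : 0 <= M by rewrite addr_ge0// mulr_ge0// ltW.
have norm_mul_cvg0 c : `|t| * c @[t --> (0 : R)] --> (0 : R).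
  rewrite -[X in _ --> X](mul0r c); apply: cvgM (cvg_cst c).
  rewrite -[X in _ --> X](normr0 R); exact: (@norm_continuous _ R).
have small : \forall t \near (0 : R), `|t| * M <= d /\ `|t| * k < 1.
  near=> t; split; near: t.
    exact: cvgr_le (norm_mul_cvg0 M) _ d0.
  exact: cvgr_lt (norm_mul_cvg0 k) _ ltr01.
have /choice[w wP] t : exists x, `|x| <= `|t| * M /\
    (`|t| * M <= d /\ `|t| * k < 1 -> x = t *: phi x).
  have [[tM tk]|] := pselect (`|t| * M <= d /\ `|t| * k < 1).
    have [x] := scaled_lipschitz_fixed_point (ltW k0) (ltW d0) phi_lip_d tM tk.
    by exists x.
  by exists 0; split=> //; rewrite normr0 mulr_ge0.
exists w; last by apply: filterS small => t; exact: (wP t).2.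
apply: norm_cvg0; apply: squeeze_cvgr (cvg_cst 0) (norm_mul_cvg0 M).
by apply: nearW => t; rewrite normr_ge0 (wP t).1.
Unshelve. all: by end_near. Qed.

End FixedPoint.

Section Tangents.
Variable R : realType.
Variables m n : nat.
Implicit Types (Om : set 'M[R]_(m, n)) (X Y D Xi : 'M[R]_(m, n)).

Lemma bouligand_tangent_curve Om X Xi (D : R -> 'M[R]_(m, n)) :
  D t @[t --> 0^'+] --> Xi ->
  (\forall t \near 0^'+, Om (X + t *: D t)) -> bouligand_tangent Om X Xi.
Proof.
move=> DXi; rewrite near_withinE => /nbhs_ballP[d /= d0 curve_in].
pose t k : R := d / 2 / k.+1%:R.
have t0 k : 0 < t k by rewrite !divr_gt0.
have tcvg : t @ \oo --> (0 : R).
  by rewrite -(mulr0 (d / 2)); apply: cvgM (@cvg_harmonic R); exact: cvg_cst.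
have Dcvg : D (t k) @[k --> \oo] --> Xi.
  apply: cvg_comp DXi => P /(tcvg _).
  by apply: (@filterS _ \oo) => k /(_ (t0 k)).
exists (fun k => X + t k *: D (t k)), t; split.
  move=> k; apply: curve_in => //; rewrite -ball_normE /ball_ /= sub0r normrN.
  rewrite gtr0_norm// /t -mulrA gtr_pMr// -invfM -natrM.
  by rewrite invf_lt1 ?ltr1n ?leq_pmulr.
split.
  rewrite -[X in _ --> X]addr0 -(scale0r Xi).
  by apply: cvgD; [exact: cvg_cst | exact: cvgZ].
split=> //; split.
  by move=> i j ij; rewrite /t ler_pM2l ?divr_gt0// lef_pV2 ?posrE // ler_nat.
split=> //; apply: cvg_trans Dcvg; apply: near_eq_cvg; apply: nearW => k.
by rewrite [X + _]addrC addrK scalerA mulVf ?scale1r// gt_eqF.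
Qed.

Lemma bouligand_tangent_line Om X D :
  (forall t, Om (X + t *: D)) -> bouligand_tangent Om X D.
Proof.
move=> line_in; apply: (@bouligand_tangent_curve _ _ _ (fun=> D)).
  exact: cvg_cst.
exact: nearW.
Qed.

Lemma sub_bouligand_tangent Om Om' X :
  Om `<=` Om' -> bouligand_tangent Om X `<=` bouligand_tangent Om' X.
Proof.
move=> sOm Xi [Xs [t [XsOm XsXi]]]; exists Xs, t.
by split=> // k; exact/sOm/XsOm.
Qed.

Lemma frechet_normal_eq0 Om X Y Xi : frechet_normal Om X Y ->
  bouligand_tangent Om X Xi -> bouligand_tangent Om X (- Xi) -> frob Y Xi = 0.
Proof.
move=> NY TXi TNXi; apply/le_anti; rewrite NY//= -oppr_le0 -linearN.
exact: NY.
Qed.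

Lemma bouligand_tangent_affine l (A : 'I_l -> 'M[R]_(m, n)) b X Xi i :
  affine_set A b X -> bouligand_tangent (affine_set A b) X Xi ->
  frob (A i) Xi = 0.
Proof.
move=> AX [Xs [t [XsA [_ [_ [_ [_ XsXi]]]]]]].
apply: (closed_cvg (fun Z => frob (A i) Z = 0) _ _ _ XsXi).
  apply: (preimage_closed _ (@closed_eq _ 0)) => Z _; exact: frob_continuous.
by apply: nearW => k; rewrite scalarZ linearB /= XsA AX subrr mulr0.
Qed.

Lemma sub_frechet_normal_affineI l (A : 'I_l -> 'M[R]_(m, n)) b Om X :
  affine_set A b X ->
  mx_minkowski_sum (normal_affine A) (frechet_normal Om X) `<=`
  frechet_normal (affine_set A b `&` Om) X.
Proof.
move=> AX _ [_ [Y [[y ->] [NY ->]]]] Xi TXi.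
rewrite frobDl frob_lincombl big1 ?add0r.
  by apply: NY; apply: sub_bouligand_tangent TXi => Z [].
move=> i _; rewrite (bouligand_tangent_affine _ AX) ?mulr0 //.
by apply: sub_bouligand_tangent TXi => Z [].
Qed.

End Tangents.

Lemma mxrank_le_detP (F : fieldType) m n r (A : 'M[F]_(m, n)) :
  (\rank A <= r)%N <->
  forall (L : 'M[F]_(r.+1, m)) (N : 'M[F]_(n, r.+1)), \det (L *m A *m N) = 0.
Proof.
split=> [Ar L N | minors0].
  apply/eqP/contraT; rewrite -unitfE -unitmxE => /mxrank_unit rk.
  have : (r.+1 <= \rank A)%N.
    by rewrite -[leqLHS]rk (leq_trans (mxrankM_maxl _ _))// mxrankM_maxr.
  by rewrite ltnNge Ar.
rewrite leqNgt; apply/negP => rA.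
have /row_fullP[K KC] := col_base_full A.
have /row_freeP[J RJ] := row_base_free A.
pose L := (pid_mx r.+1 : 'M[F]_(r.+1, _)) *m K.
pose N := J *m (pid_mx r.+1 : 'M[F]_(_, r.+1)).
have LAN : L *m A *m N = 1%:M.
  have -> : L *m A *m N =
      pid_mx r.+1 *m (K *m col_base A) *m (row_base A *m J) *m pid_mx r.+1.
    by rewrite -{1}(mulmx_base A) !mulmxA.
  rewrite KC RJ !mulmx1 mul_pid_mx minnn (minn_idPr rA).
  exact: pid_mx_1.
by have /eqP := minors0 L N; rewrite LAN det1 oner_eq0.
Qed.

Section LowRank.
Variables (R : realType) (m n : nat).
Implicit Types X Y H Xi : 'M[R]_(m, n).

Lemma closed_low_rank r : closed (low_rank m n r : set 'M[R]_(m, n)).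
Proof.
have -> : low_rank m n r =
    \bigcap_(LN in [set: 'M[R]_(r.+1, m) * 'M[R]_(n, r.+1)])
      [set X | \det (LN.1 *m X *m LN.2) = 0].
  apply/seteqP; split=> X.
    by move=> /mxrank_le_detP minors0 [L N] _; exact: minors0.
  by move=> minors0; apply/mxrank_le_detP => L N; exact: (minors0 (L, N)).
apply: closed_bigI => -[L N] _ /=.
pose F : {linear _ -> _} := (mulmxr N \o mulmx L)%FUN.
apply: (preimage_closed _ (@closed_eq _ 0)) => X _.
apply: (@continuous_comp _ _ _ F (fun Z => \det Z)).
  exact: mx_linear_continuous.
exact: det_continuous.
Qed.

Lemma bouligand_tangent_low_rank X Xi :
  bouligand_tangent (low_rank m n (\rank X)) X Xi ->
  exists (M : 'M[R]_m) (N : 'M[R]_n), Xi = M *m X + X *m N.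
Proof.
move=> [Xs [t [Xs_rank [XsX [t0 [_ [_ XsXi]]]]]]].
pose P := X *m pinvmx X.
have PX : P *m X = X by rewrite mulmxKpV.
(* Off the column space of [X], rescale [Xs k] by [(t k)^-1]: this keeps the
   rank, and the limit [W] involves [Xi]. *)
pose W := P *m X + (1%:M - P) *m Xi.
pose Ws k := P *m Xs k + (1%:M - P) *m ((t k)^-1 *: (Xs k - X)).
have Ws_rank k : (\rank (Ws k) <= \rank X)%N.
  apply: leq_trans (Xs_rank k); rewrite /Ws -scalemxAr mulmxBr (mulmxBl _ _ X).
  by rewrite mul1mx PX subrr subr0 scalemxAl -mulmxDl mxrankM_maxr.
have WsW : Ws @ \oo --> W.
  apply: cvgD; first exact: (cvg_mx_linear (f := mulmx P) XsX).
  exact: (cvg_mx_linear (f := mulmx (1%:M - P)) XsXi).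
have W_rank : (\rank W <= \rank X)%N.
  by apply: (closed_cvg _ (@closed_low_rank _) _ _ WsW); exact: nearW.
have PP : P *m P = P by rewrite [LHS]mulmxA PX.
have PW : P *m W = X.
  by rewrite mulmxDr !PX mulmxA mulmxBr mulmx1 PP subrr mul0mx addr0.
have /submxP[M WE] : (W <= X)%MS.
  have XW : (X <= W)%MS by rewrite -{1}PW submxMl.
  by rewrite -(geq_leqif (mxrank_leqif_sup XW)).
exists (M - 1%:M), (pinvmx X *m Xi).
rewrite mulmxBl -WE mul1mx /W PX [X + _]addrC addrK mulmxBl mul1mx.
by rewrite mulmxA subrK.
Qed.

Definition low_rank_normal X : set 'M[R]_(m, n) :=
  [set Y | X^T *m Y = 0 /\ Y *m X^T = 0].

Lemma low_rank_normal_frechet X :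
  low_rank_normal X `<=` frechet_normal (low_rank m n (\rank X)) X.
Proof.
move=> Y [XY YX] _ /bouligand_tangent_low_rank[M [N ->]].
by rewrite linearD /= frob_mulmxr YX frob_mulmxl XY !(frobC 0) !linear0 addr0.
Qed.

(* The initial velocity of the curve [(1 + t H X^T) X (1 + t X^T H)]. *)
Definition rank_velocity X H := X *m X^T *m H + H *m X^T *m X.

Fact rank_velocity_is_linear X : linear (rank_velocity X).
Proof.
move=> a H K; rewrite /rank_velocity mulmxDr !mulmxDl -!scalemxAl -scalemxAr.
by rewrite scalerDr addrACA.
Qed.

HB.instance Definition _ X :=
  GRing.isLinear.Build R 'M[R]_(m, n) 'M[R]_(m, n) *:%R (rank_velocity X)
    (rank_velocity_is_linear X).

Lemma frob_rank_velocity X Y H :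
  frob Y (rank_velocity X H) =
  frob (X^T *m Y) (X^T *m H) + frob (Y *m X^T) (H *m X^T).
Proof.
by rewrite linearD /= -mulmxA frob_mulmxl [X in _ + X]frob_mulmxr.
Qed.

Lemma rank_velocity_self_adjoint X Y H :
  frob (rank_velocity X Y) H = frob Y (rank_velocity X H).
Proof.
by rewrite frobC !frob_rank_velocity !(frobC (_ *m H)) !(frobC (H *m _)).
Qed.

Lemma low_rank_normal_velocity X Y :
  frob Y (rank_velocity X Y) = 0 -> low_rank_normal X Y.
Proof.
rewrite frob_rank_velocity => /eqP; rewrite paddr_eq0 ?frob_ge0//.
by case/andP => /eqP/frob_eq0 XY /eqP/frob_eq0 YX.
Qed.

Lemma low_rank_quadratic_curve X t H :
  low_rank m n (\rank X)
    (X + t *: rank_velocity X H + t ^+ 2 *: (H *m (X^T *m X *m X^T) *m H)).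
Proof.
have -> : X + t *: rank_velocity X H + t ^+ 2 *: (H *m (X^T *m X *m X^T) *m H) =
    (1%:M + t *: (H *m X^T)) *m X *m (1%:M + t *: (X^T *m H)).
  rewrite mulmxDl mul1mx mulmxDr mulmx1 mulmxDl -!scalemxAl -!scalemxAr.
  rewrite /rank_velocity scalerDr scalerA -expr2 !mulmxA !addrA.
  by rewrite [X + _ + _]addrAC.
exact: leq_trans (mxrankM_maxl _ _) (mxrankM_maxr _ _).
Qed.

End LowRank.

Section AffineIntersection.
Variables (R : realType) (m n l : nat).
Variables (A : 'I_l -> 'M[R]_(m, n)) (b : 'I_l -> R).
Implicit Types (X : 'M[R]_(m, n)) (Om : set 'M[R]_(m, n)).

Lemma bouligand_tangent_affineI p q Om X
    (D : {linear 'M[R]_(p, q) -> 'M[R]_(m, n)})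
    (Q : 'M[R]_(p, q) -> 'M[R]_(m, n)) (G : 'I_l -> 'M[R]_(p, q)) H :
  affine_set A b X -> biorthogonal A (fun j => D (G j)) ->
  (forall t Z, Om (X + t *: D Z + t ^+ 2 *: Q Z)) ->
  lipschitz_on Q (nbhs (H, H)) ->
  (forall i, frob (A i) (D H) = 0) ->
  bouligand_tangent (affine_set A b `&` Om) X (D H).
Proof.
move=> AX AG curve_in Q_lip AH.
(* Replacing [H] by [H + w] adds [t <A i, D w>] to the constraints, which has to
   cancel their second order error: [w = - t (sum_i <A i, Q (H + w)> G i)]. *)
have phi_lip := lipschitz_on_linear_shift (\- frob_expansion A G) Q_lip.
have [w w0 wE] := small_scaling_fixed_point phi_lip.
have w0r : w t @[t --> 0^'+] --> 0 by exact: cvg_at_right_filter.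
apply: (@bouligand_tangent_curve _ _ _ _ _ _
  (fun t => D (H + w t) + t *: Q (H + w t))).
  have Hw_cvg : H + w t @[t --> 0^'+] --> H.
    by rewrite -[X in _ --> X]addr0; apply: cvgD; first exact: cvg_cst.
  rewrite -[X in _ --> X]addr0 -(scale0r (Q H)); apply: cvgD.
    exact: (cvg_mx_linear (f := D) Hw_cvg).
  apply: cvgZ; first exact: cvg_at_right_filter.
  exact: (continuous_cvg _ (lipschitz_on_continuous Q_lip) Hw_cvg).
apply: cvg_within; apply: filterS wE => t wE.
split=> [i|]; last first.
  by rewrite scalerDr scalerA -expr2 addrA; exact: curve_in.
have Dw : frob (A i) (D (w t)) = - (t * frob (A i) (Q (H + w t))).
  rewrite {1}wE linearZ linearN /= linear_frob_expansion scalarZ linearN /=.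
  by rewrite frob_expansion_biorthogonal// mulrN.
rewrite linearD /= AX scalarZ linearD scalarZ linearD linearD /= AH add0r Dw.
by rewrite addNr mulr0 addr0.
Qed.

Lemma frechet_normal_affine_low_rank X :
  affine_set A b X -> lin_indep_mod (low_rank_normal X) A ->
  frechet_normal (affine_set A b `&` low_rank m n (\rank X)) X =
  mx_minkowski_sum (normal_affine A)
    (frechet_normal (low_rank m n (\rank X)) X).
Proof.
move=> AX indA; apply/seteqP; split; last exact: sub_frechet_normal_affineI.
pose vA i := rank_velocity X (A i).
have [|G AG] := @lin_indep_biorthogonal _ _ _ _ vA.
  apply/lin_indep_modP; apply: sub_lin_indep_mod indA => Z /= vZ.
  by apply: low_rank_normal_velocity; rewrite vZ linear0.
pose B i := rank_velocity X (G i).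
have AB : biorthogonal A B.
  by move=> i j; rewrite -rank_velocity_self_adjoint; exact: AG.
have tangent H : (forall i, frob (A i) (rank_velocity X H) = 0) ->
    bouligand_tangent (affine_set A b `&` low_rank m n (\rank X)) X
      (rank_velocity X H).
  apply: (bouligand_tangent_affineI (D := rank_velocity X) AX AB).
    exact: low_rank_quadratic_curve.
  exact: lipschitz_on_quadratic.
move=> Y NY; exists (frob_expansion B A Y), (Y - frob_expansion B A Y).
split; first by exists (fun i => frob (B i) Y).
split; last by rewrite addrC subrK.
apply: low_rank_normal_frechet; apply: low_rank_normal_velocity.
set Z := Y - _; pose H := Z - frob_expansion A G (rank_velocity X Z).
have vH : rank_velocity X H =
    rank_velocity X Z - frob_expansion A B (rank_velocity X Z).
  by rewrite linearB /= linear_frob_expansion.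
have AH i : frob (A i) (rank_velocity X H) = 0.
  by rewrite vH linearB /= frob_expansion_biorthogonal// subrr.
have -> : frob Z (rank_velocity X Z) = frob Y (rank_velocity X H).
  by rewrite vH [RHS]linearB /= -frob_expansion_adjoint -frobBl.
apply: (frechet_normal_eq0 NY); first exact: tangent.
by rewrite -linearN; apply: tangent => i; rewrite !linearN /= AH oppr0.
Qed.

Lemma frechet_normal_affine_rank_deficient X r :
  affine_set A b X -> (\rank X < r)%N -> lin_indep (fun i => A i *m X^T) ->
  frechet_normal (affine_set A b `&` low_rank m n r) X `<=` normal_affine A.
Proof.
move=> AX Xr /lin_indep_biorthogonal[G AG].
pose B i := G i *m X.
have AB : biorthogonal A B by move=> i j; rewrite frob_mulmxr AG.
move=> Y NY; exists (fun i => frob (B i) Y).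
rewrite -[RHS]/(frob_expansion B A Y); apply: subr0_eq.
apply/matrixP => a c; rewrite [RHS]mxE -frob_delta.
set E := delta_mx a c; pose D := E - frob_expansion A B E.
have -> : frob (Y - frob_expansion B A Y) E = frob Y D.
  by rewrite [RHS]linearB /= -frob_expansion_adjoint -frobBl.
have line_in t : (affine_set A b `&` low_rank m n r) (X + t *: D).
  split=> [i|].
    rewrite linearD /= scalarZ linearB /= frob_expansion_biorthogonal//.
    by rewrite subrr mulr0 addr0.
  have -> : X + t *: D = (1%:M - t *: frob_expansion A G E) *m X + t *: E.
    rewrite mulmxBl mul1mx -scalemxAl -[_ *m X]/(mulmxr X _).
    by rewrite linear_frob_expansion scalerBr -addrA [- _ + _]addrC.
  apply: leq_trans (mxrank_add _ _) (leq_trans _ Xr); rewrite -addn1 leq_add//.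
    exact: mxrankM_maxr.
  by rewrite (leq_trans (mxrank_scale _ _))// mxrank_delta.
apply: (frechet_normal_eq0 NY); apply: bouligand_tangent_line => // t.
by rewrite scalerN -scaleNr.
Qed.

End AffineIntersection.

Section SVD.
Variable R : realType.

Lemma is_svd_tr m n (X : 'M[R]_(m, n)) s U S V :
  is_svd X s U S V -> is_svd X^T s V S^T U.
Proof.
move=> [oU oV [S_off S_pos S_tail S_dec] XE]; split=> //.
  split=> [i j ij|i j ij|i j ij|i i' j j' ij ij']; rewrite ?mxE.
  - by apply: S_off; apply/nesym.
  - by rewrite ij; apply: S_pos.
  - by rewrite ij; apply: S_tail.
  - by rewrite ij ij'; apply: S_dec.
by rewrite XE !trmx_mul trmxK mulmxA.
Qed.

Lemma svd_leading_row_eq0 m n (X A : 'M[R]_(m, n)) s U S V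
    (i : 'I_m) (j : 'I_n) :
  is_svd X s U S V -> X^T *m A = 0 -> (s <= n)%N -> (i < s)%N ->
  (U^T *m A *m V) i j = 0.
Proof.
move=> [oU oV [S_off S_pos _ _] XE] XA sn is_.
have SUAV : S^T *m (U^T *m A *m V) = 0.
  have -> : S^T *m (U^T *m A *m V) = V^T *m (X^T *m A) *m V.
    by rewrite XE !trmx_mul trmxK !mulmxA oV mul1mx.
  by rewrite XA mulmx0 mul0mx.
pose k := Ordinal (leq_trans is_ sn).
have /matrixP/(_ k j) := SUAV; rewrite mxE (bigD1 i) //= big1 ?addr0.
  by rewrite !mxE => /eqP; rewrite mulf_eq0 gt_eqF ?S_pos //= => /eqP.
move=> a ai; rewrite mxE S_off ?mul0r //= => ak.
by case/eqP: ai; apply/val_inj.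
Qed.

Lemma svd_leading_col_eq0 m n (X A : 'M[R]_(m, n)) s U S V
    (i : 'I_m) (j : 'I_n) :
  is_svd X s U S V -> A *m X^T = 0 -> (s <= m)%N -> (j < s)%N ->
  (U^T *m A *m V) i j = 0.
Proof.
move=> /is_svd_tr svdX AX sm js.
have -> : U^T *m A *m V = (V^T *m A^T *m U)^T.
  by rewrite !trmx_mul !trmxK mulmxA.
by rewrite mxE (svd_leading_row_eq0 _ svdX)// -trmx_mul AX trmx0.
Qed.

Fact T_mx_is_linear m n s (U : 'M[R]_m) (V : 'M[R]_n) : linear (T_mx s U V).
Proof.
move=> a A B; apply/matrixP => i j; rewrite [RHS]mxE [X in _ = X + _]mxE.
rewrite ![T_mx _ _ _ _ _ _]mxE mulmxDr mulmxDl -scalemxAr -scalemxAl.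
by case: ifP => _; rewrite ?mulr0 ?addr0// [LHS]mxE [X in X + _ = _]mxE.
Qed.

HB.instance Definition _ m n s (U : 'M[R]_m) (V : 'M[R]_n) :=
  GRing.isLinear.Build R 'M[R]_(m, n) 'M[R]_(m, n) *:%R (T_mx s U V)
    (T_mx_is_linear s U V).

Fact R_mx_is_linear m n s (sn : (s <= n)%N) (U : 'M[R]_m) (V : 'M[R]_n) :
  linear (R_mx sn U V).
Proof.
move=> a A B; apply/matrixP => i j; rewrite [RHS]mxE [X in _ = X + _]mxE.
rewrite ![R_mx _ _ _ _ _ _]mxE mulmxDr mulmxDl -scalemxAr -scalemxAl.
by rewrite [LHS]mxE [X in X + _ = _]mxE.
Qed.

HB.instance Definition _ m n s (sn : (s <= n)%N) (U : 'M[R]_m) (V : 'M[R]_n) :=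
  GRing.isLinear.Build R 'M[R]_(m, n) 'M[R]_(m, s) *:%R (R_mx sn U V)
    (R_mx_is_linear sn U V).

Lemma T_mx_low_rank_normal m n (X A : 'M[R]_(m, n)) s U S V :
  is_svd X s U S V -> (s <= m)%N -> (s <= n)%N ->
  low_rank_normal X A -> T_mx s U V A = 0.
Proof.
move=> svdX sm sn [XA AX]; apply/matrixP => i j; rewrite [LHS]mxE [RHS]mxE.
case: ifP => // /orP[i_s|j_s].
  exact: (svd_leading_row_eq0 _ svdX XA sn i_s).
exact: (svd_leading_col_eq0 _ svdX AX sm j_s).
Qed.

Lemma R_mx_eq0 m n (X A : 'M[R]_(m, n)) s (sn : (s <= n)%N) U S V :
  is_svd X s U S V -> (s <= m)%N -> A *m X^T = 0 -> R_mx sn U V A = 0.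
Proof.
move=> svdX sm AX; apply/matrixP => i j; rewrite [LHS]mxE [RHS]mxE.
by rewrite (svd_leading_col_eq0 _ svdX AX)//=.
Qed.

End SVD.

Theorem theorem3p1 (R : realType) (m n r l : nat)
  (A : 'I_l -> 'M[R]_(m, n)) (b : 'I_l -> R) (X : 'M[R]_(m, n))
  (s : nat) (U : 'M[R]_m) (S : 'M[R]_(m, n)) (V : 'M[R]_n)
  (hmn : (n <= m)%N) (hr : (r < n)%N)
  (hXL : affine_set A b X) (hXM : low_rank m n r X)
  (hs : \rank X = s) (hsvd : is_svd X s U S V) :
  ((s = r -> lin_indep (fun i => T_mx s U V (A i)) ->
     frechet_normal (affine_set A b `&` low_rank m n r) X =
     mx_minkowski_sum (normal_affine A) (frechet_normal (low_rank m n r) X))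
  /\
  (forall hsn : (s <= n)%N, (s < r)%N ->
     lin_indep (fun i => R_mx hsn U V (A i)) ->
     frechet_normal (affine_set A b `&` low_rank m n r) X =
       mx_minkowski_sum (normal_affine A) (frechet_normal (low_rank m n r) X) /\
     mx_minkowski_sum (normal_affine A) (frechet_normal (low_rank m n r) X) =
       normal_affine A)).
Proof.
have sm : (s <= m)%N by rewrite -hs rank_leq_row.
have sn : (s <= n)%N by rewrite -hs rank_leq_col.
split=> [sr /lin_indep_modP indT | hsn sr /lin_indep_modP indR].
  rewrite -sr -hs; apply: frechet_normal_affine_low_rank => //.
  by apply: sub_lin_indep_mod indT => Z; exact: (T_mx_low_rank_normal hsvd).
set N := frechet_normal (_ `&` _) X; set M := mx_minkowski_sum _ _.
have N_sub : N `<=` normal_affine A.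
  apply: frechet_normal_affine_rank_deficient; rewrite ?hs//.
  apply/(lin_indep_modP (mulmxr X^T)); apply: sub_lin_indep_mod indR => Z.
  exact: (R_mx_eq0 _ hsvd).
have M_sub : M `<=` N by exact: sub_frechet_normal_affineI.
have sub_M : normal_affine A `<=` M.
  move=> Y AY; exists Y, 0; split=> //; split; last by rewrite addr0.
  by move=> Xi _; rewrite frobC linear0.
split; apply/seteqP; split=> //; first exact: subset_trans N_sub sub_M.
exact: subset_trans M_sub N_sub.
Qed.
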